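(* Consider an integer $m$ of the form $m = 2^q$ for some integer $q \geq 1$. There exist an integer $n \geq m$, a positive semidefinite matrix $\bm{A}\in\mathcal{S}^{nm}_+$, and an optimal solution $\bm{W}$ to the semidefinite relaxation $$\max_{\bm{W} \in \mathcal{S}^{nm}_+} \ \langle \bm{A}, \bm{W} \rangle \quad \text{s.t.} \quad \sum_{i=1}^m \bm{W}^{(i,i)} \preceq \bm{I}_n, \qquad \operatorname{tr}\big( \bm{W}^{(j,j')} \big)= \delta_{j,j'} \ \ \forall j, j' \in \{1,\dots,m\},$$ such that the solutions $\bm{Q}\in\mathbb{R}^{n\times m}$ generated by the relax-and-project algorithm from $\bm{W}$ (defined in the context) satisfy $$\operatorname{vec}(\bm{Q})^\top \bm{A} \operatorname{vec}(\bm{Q}) = \frac{m+2}{3m}\, \langle \bm{A},\bm{W} \rangle \quad \text{almost surely.}$$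
   Context: $\mathcal{S}^{d}_+$ is the cone of $d\times d$ real symmetric positive semidefinite matrices, $\preceq$ is the Loewner order, $\langle\cdot,\cdot\rangle$ is the Frobenius inner product, $\bm{I}_d$ is the $d\times d$ identity matrix, $\delta_{j,j'}$ is the Kronecker delta. $\operatorname{vec}(\bm{X})\in\mathbb{R}^{nm}$ stacks the columns of $\bm{X}\in\mathbb{R}^{n\times m}$. An $nm\times nm$ matrix $\bm{W}$ is viewed as an $m\times m$ array of $n\times n$ blocks, and $\bm{W}^{(i,j)}$ denotes its $(i,j)$ block. Relax-and-project algorithm: given an optimal solution $\bm{W}$ of the relaxation, sample a random matrix $\bm{G}\in\mathbb{R}^{n\times m}$ with $\operatorname{vec}(\bm{G}) \sim \mathcal{N}(\bm{0}_{nm}, \bm{W})$ (centered Gaussian with covariance $\bm{W}$, possibly degenerate); compute a singular value decomposition $\bm{G}=\bm{U}\bm{\Sigma}\bm{V}^\top$ with $\bm{U}\in\mathbb{R}^{n\times m}$, $\bm{U}^\top\bm{U}=\bm{I}_m$, $\bm{\Sigma}\in\mathbb{R}^{m\times m}$ diagonal with nonnegative entries, and $\bm{V}\in\mathbb{R}^{m\times m}$ orthogonal; return $\bm{Q}=\bm{U}\bm{V}^\top$. *)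

(* Defs.v *)
From mathcomp Require Export all_boot all_order all_algebra.
From mathcomp Require Export all_classical all_reals all_analysis.

Set Implicit Arguments.
Unset Strict Implicit.
Unset Printing Implicit Defensive.

Import Order.TTheory GRing.Theory Num.Theory.

Local Open Scope classical_set_scope.
Local Open Scope ring_scope.

Definition psd (R : realType) (d : nat) (A : 'M[R]_d) : Prop :=
  A^T = A /\ forall x : 'cV[R]_d, 0 <= (x^T *m A *m x) 0 0.

Definition loewner_le (R : realType) (d : nat) (A B : 'M[R]_d) : Prop :=
  psd (B - A).

Definition frobenius (R : realType) (d : nat) (A B : 'M[R]_d) : R :=
  \tr (A^T *m B).

(* Column stacking. [mxvec] lists entries row by row, so it is applied to the
   transpose: the (j, i) position of a vector of size m * n is occupied by the
   entry of X in row i and column j. *)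
Definition vec (R : realType) (n m : nat) (X : 'M[R]_(n, m)) : 'cV[R]_(m * n) :=
  (mxvec X^T)^T.

(* The (i, j) block of W seen as an m x m array of n x n blocks; the indexing
   matches [vec], so that block (vec X *m (vec Y)^T) i j = col i X *m (col j Y)^T. *)
Definition block (R : realType) (n m : nat) (W : 'M[R]_(m * n)) (i j : 'I_m) :
    'M[R]_n :=
  \matrix_(a, b) W (mxvec_index i a) (mxvec_index j b).

Definition feasible (R : realType) (n m : nat) (W : 'M[R]_(m * n)) : Prop :=
  [/\ psd W,
      loewner_le (\sum_(i < m) block W i i) 1%:M &
      forall j j' : 'I_m, \tr (block W j j') = (j == j')%:R].

Definition optimal (R : realType) (n m : nat) (A W : 'M[R]_(m * n)) : Prop :=
  feasible W /\
  forall W' : 'M[R]_(m * n), feasible W' -> frobenius A W' <= frobenius A W.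

(* The law N(0, v) on the line. For v = 0 it is the Dirac mass at 0, which has
   to be singled out because [normal_prob 0 0] is the uniform law on [0, 1]. *)
Definition centered_normal (R : realType) (v : R) (B : set R) : \bar R :=
  if v == 0 then \d_(0 : R) B else normal_prob 0 (Num.sqrt v) B.

(* X ~ N(0, C), possibly degenerate: every linear functional u^T X has law
   N(0, u^T C u). *)
Definition gaussian_vector (R : realType) (disp : measure_display)
    (T : measurableType disp) (P : probability T R) (N : nat)
    (X : T -> 'cV[R]_N) (C : 'M[R]_N) : Prop :=
  (forall i : 'I_N, measurable_fun setT (fun w => X w i 0)) /\
  forall (u : 'cV[R]_N) (B : set R), measurable B ->
    P ((fun w => (u^T *m X w) 0 0) @^-1` B) =
    centered_normal ((u^T *m C *m u) 0 0) B.

Definition is_svd (R : realType) (n m : nat) (G : 'M[R]_(n, m))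
    (U : 'M[R]_(n, m)) (S V : 'M[R]_m) : Prop :=
  [/\ U^T *m U = 1%:M,
      is_diag_mx S /\ (forall i : 'I_m, 0 <= S i i),
      V^T *m V = 1%:M &
      G = U *m S *m V^T].

(* A relation rather than a function: when G is rank deficient, U *m V^T
   depends on the singular value decomposition that is computed. *)
Definition projection_of (R : realType) (n m : nat) (G Q : 'M[R]_(n, m)) : Prop :=
  exists (U : 'M[R]_(n, m)) (S V : 'M[R]_m), is_svd G U S V /\ Q = U *m V^T.

(* Q is the random output of the relax-and-project algorithm run from W. *)
Definition relax_and_project (R : realType) (disp : measure_display)
    (T : measurableType disp) (P : probability T R) (n m : nat)
    (W : 'M[R]_(m * n)) (Q : T -> 'M[R]_(n, m)) : Prop :=
  exists G : T -> 'M[R]_(n, m),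
    gaussian_vector P (fun w => vec (G w)) W /\
    forall w : T, projection_of (G w) (Q w).

(* Main.v *)
(* For [g] in R^m let [G g] be the linear map from R^m to the m x m matrices
   [x |-> t (g x^T + x g^T) / 2 + (1 - t) / m <g, x> I] with [t^2 = 2 / (m + 2)],
   so that [n = m^2]. The relaxed solution [W] is the covariance of [vec (G g)]
   for [g] standard Gaussian, and [A] is the quadratic form [X |-> |X^T vec I|^2],
   bounded by m on the feasible set because the sum of the diagonal blocks is at
   most the identity. The value of [t] makes the Gram tensor of the columns of
   [G] totally symmetric, so that [G^T G = (|g|^2 I + 2 g g^T) / (m + 2)], while
   [G^T vec I = g]. As [Q Q^T] is the projection onto the column space of [G],
   the value of [Q] is [g^T (G^T G)^-1 g = (m + 2) / 3] as soon as [g <> 0]. *)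

Require Import Defs.
From mathcomp Require Import ring measurable_realfun.

Set Implicit Arguments.
Unset Strict Implicit.
Unset Printing Implicit Defensive.

Import Order.TTheory GRing.Theory Num.Theory.

Local Open Scope classical_set_scope.
Local Open Scope ring_scope.

(** * Almost sure support of degenerate Gaussian vectors *)

Lemma measurable_mulmx_cV (R : realType) (disp : measure_display)
    (T : measurableType disp) (N : nat) (X : T -> 'cV[R]_N) (u : 'cV[R]_N) :
  (forall i, measurable_fun setT (fun w => X w i 0)) ->
  measurable_fun setT (fun w => (u^T *m X w) 0 0).
Proof.
move=> mX.
rewrite (_ : (fun _ => _) = (fun w => \sum_i u i 0 * X w i 0)).
  by apply: measurable_sum => i; exact: measurable_funM.
by apply/funext => w; rewrite mxE; apply: eq_bigr => i _; rewrite mxE.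
Qed.

Lemma gaussian_functional_eq0 (R : realType) (disp : measure_display)
    (T : measurableType disp) (P : probability T R) (N : nat)
    (X : T -> 'cV[R]_N) (C : 'M[R]_N) (u : 'cV[R]_N) :
  gaussian_vector P X C -> (u^T *m C *m u) 0 0 = 0 ->
  {ae P, forall w, (u^T *m X w) 0 0 = 0}.
Proof.
move=> [mX lawX] u0.
exists ((fun w => (u^T *m X w) 0 0) @^-1` (~` [set 0])); split.
- rewrite -[X in measurable X]setTI; apply: measurable_mulmx_cV => //.
  exact: measurableC.
- rewrite lawX; last exact: measurableC.
  by rewrite /centered_normal u0 eqxx diracE memNset //= => /(_ erefl).
- by move=> w.
Qed.

(** A nonzero variance puts the law in the branch with a density, for which singletons are null. *)
Lemma gaussian_functional_neq0 (R : realType) (disp : measure_display)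
    (T : measurableType disp) (P : probability T R) (N : nat)
    (X : T -> 'cV[R]_N) (C : 'M[R]_N) (u : 'cV[R]_N) :
  gaussian_vector P X C -> (u^T *m C *m u) 0 0 != 0 ->
  {ae P, forall w, (u^T *m X w) 0 0 != 0}.
Proof.
move=> [mX lawX] u0.
exists ((fun w => (u^T *m X w) 0 0) @^-1` [set 0]); split.
- by rewrite -[X in measurable X]setTI; exact: measurable_mulmx_cV.
- by rewrite lawX // /centered_normal (negbTE u0) /normal_prob integral_set1.
- by move=> w /= /negP; rewrite negbK => /eqP.
Qed.

(** Each row of [K = 1 - F *m F^T] is a functional of zero variance, since [K *m F = 0]; finitely
    many null events are discarded. *)
Lemma gaussian_range (R : realType) (disp : measure_display)
    (T : measurableType disp) (P : probability T R) (N r : nat)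
    (X : T -> 'cV[R]_N) (F : 'M[R]_(N, r)) :
  gaussian_vector P X (F *m F^T) -> F^T *m F = 1%:M ->
  {ae P, forall w, X w = F *m (F^T *m X w)}.
Proof.
move=> gX FF; set K := 1%:M - F *m F^T.
have KF : K *m F = 0 by rewrite mulmxBl mul1mx -mulmxA FF mulmx1 subrr.
have rowK (i : 'I_N) : {ae P, forall w, (row i K *m X w) 0 0 = 0}.
  rewrite -[row i K]trmxK; apply: (gaussian_functional_eq0 gX).
  by rewrite trmxK mulmxA -row_mul KF row0 !mul0mx mxE.
apply: filterS (filter_forall _ rowK) => w Kw.
apply/eqP; rewrite mulmxA -subr_eq0 -[X in X - _]mul1mx -mulmxBl -/K.
by apply/eqP/colP => i; rewrite [RHS]mxE -[RHS](Kw i) -row_mul [RHS]mxE.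
Qed.

(** The first coordinate of [F^T *m X] has variance 1, so it alone is almost surely nonzero. *)
Lemma gaussian_neq0 (R : realType) (disp : measure_display)
    (T : measurableType disp) (P : probability T R) (N r : nat)
    (X : T -> 'cV[R]_N) (F : 'M[R]_(N, r)) :
  gaussian_vector P X (F *m F^T) -> F^T *m F = 1%:M -> (0 < r)%N ->
  {ae P, forall w, F^T *m X w != 0}.
Proof.
move=> gX FF r0; pose i := Ordinal r0.
have := @gaussian_functional_neq0 R disp T P N X _ (col i F) gX.
rewrite tr_col mulmxA -row_mul FF -mulmxA -row_mul.
rewrite mul1mx colE mulmxA FF mul1mx [row i _ 0 0]mxE mxE !eqxx.
move=> /(_ (oner_neq0 _)); apply: filterS => w.
by apply: contra => /eqP FX; rewrite -row_mul FX row0 mxE.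
Qed.

(** * Orthogonal projection read off from any singular value decomposition *)

(* [G^T *m G *m N = 1%:M] makes [G *m N *m G^T] the orthogonal projection onto
   the column space of [G], so [Q *m Q^T] does not depend on the decomposition. *)
Lemma projection_mul_tr (R : realType) (n m : nat) (G Q : 'M[R]_(n, m)) (N : 'M[R]_m) :
  projection_of G Q -> G^T *m G *m N = 1%:M -> Q *m Q^T = G *m N *m G^T.
Proof.
move=> [U] [S] [V] [[UU _ VV ->] ->].
rewrite !trmx_mul !trmxK => GN.
have VV' : V *m V^T = 1%:M by exact: mulmx1C.
have : S^T *m (S *m V^T *m N *m V) = 1%:M.
  transitivity (V^T *m (V *m (S^T *m U^T) *m (U *m S *m V^T) *m N) *m V).
    by rewrite !mulmxA VV mul1mx -!mulmxA (mulmxA U^T) UU mul1mx.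
  by rewrite GN mulmx1 VV.
(* One-sided inverses of square matrices are two-sided, so the factor between [U] and [U^T] in
   [G *m N *m G^T] is the identity. *)
move=> /mulmx1C SN.
transitivity (U *m (S *m V^T *m N *m V *m S^T) *m U^T).
  by rewrite SN mulmx1 -mulmxA (mulmxA V^T) VV mul1mx.
by rewrite !mulmxA.
Qed.

(** * Stacked indices and Kronecker sums *)

Lemma sum_mxvec_index (R : nmodType) (p q : nat) (F : 'I_(p * q) -> R) :
  \sum_a F a = \sum_i \sum_j F (mxvec_index i j).
Proof.
rewrite pair_bigA /= (reindex (uncurry (@mxvec_index p q))) /=.
  by apply: eq_bigr => -[].
exact: curry_mxvec_bij.
Qed.

Lemma vecE (R : realType) (n m : nat) (X : 'M[R]_(n, m)) j a :
  vec X (mxvec_index j a) 0 = X a j.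
Proof. by rewrite mxE mxvecE mxE. Qed.

Lemma vec_inj (R : realType) (n m : nat) : injective (@vec R n m).
Proof.
by move=> X Y XY; apply/matrixP => a j; rewrite -(vecE X) XY vecE.
Qed.

Lemma sum_eqr (R : pzSemiRingType) (m : nat) (k : 'I_m) (F : 'I_m -> R) :
  \sum_i (k == i)%:R * F i = F k.
Proof.
rewrite (bigD1 k) //= eqxx mul1r big1 ?addr0 // => i.
by rewrite eq_sym => /negbTE ->; rewrite mul0r.
Qed.

(** * The symmetric tensor and its Gram identity *)

(* The matrix [G e_k e_j = t (e_k e_j^T + e_j e_k^T) / 2 + (1 - t) / m <e_k, e_j> I]. *)
Definition sym_tensor {R : realType} {m : nat} (t : R) (k j : 'I_m) : 'M[R]_m :=
  \matrix_(i, l) (t / 2 * ((k == i)%:R * (j == l)%:R + (j == i)%:R * (k == l)%:R) +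
                  (1 - t) / m%:R * (k == j)%:R * (i == l)%:R).

Definition sym_col {R : realType} {m : nat} (t : R) (k : 'I_m) :
    'M[R]_(m * m, m) :=
  \matrix_(a, j) mxvec (sym_tensor t k j) 0 a.

(** The Frobenius pairing with [Y] sees only the symmetric part and the trace of [Y]. The Gram
    identity, the trace identity and the Bessel bound all start from it. *)
Lemma sum_sym_col {R : realType} {m : nat} (t : R) (k j : 'I_m) (Y : 'M[R]_m) :
  \sum_a sym_col t k a j * mxvec Y 0 a =
  t / 2 * (Y k j + Y j k) + (1 - t) / m%:R * (k == j)%:R * \tr Y.
Proof.
rewrite sum_mxvec_index.
transitivity (\sum_i (t / 2 * ((k == i)%:R * Y i j + (j == i)%:R * Y i k) +
   (1 - t) / m%:R * (k == j)%:R * Y i i)).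
  apply: eq_bigr => i _.
  transitivity (\sum_l (t / 2 * ((k == i)%:R * ((j == l)%:R * Y i l)
     + (j == i)%:R * ((k == l)%:R * Y i l)) +
     (1 - t) / m%:R * (k == j)%:R * ((i == l)%:R * Y i l))).
    by apply: eq_bigr => l _; rewrite !mxE !mxvecE !mxE; ring.
  by rewrite big_split -!mulr_sumr big_split -!mulr_sumr /= !sum_eqr.
by rewrite big_split -!mulr_sumr big_split /= !sum_eqr.
Qed.

(* The coefficient of [(k == j)%:R * (l == j')%:R] is [(1 - t ^+ 2) / m%:R]; the
   value of [t] is the one for which it equals the two others, [t ^+ 2 / 2]. *)
Lemma gram_sym_col {R : realType} {m : nat} (t : R) (k l j j' : 'I_m) :
  t ^+ 2 = 2 / (m%:R + 2) ->
  \sum_a sym_col t k a j * sym_col t l a j' =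
  ((k == l)%:R * (j == j')%:R + (k == j')%:R * (l == j)%:R +
   (k == j)%:R * (l == j')%:R) / (m%:R + 2).
Proof.
move=> t2.
have m0 : m%:R != 0 :> R by rewrite pnatr_eq0; case: m k {l j j' t2} => [[]|].
have m2 : m%:R + 2 != 0 :> R by rewrite -natrD pnatr_eq0 addn2.
rewrite (eq_bigr (fun a => sym_col t k a j * mxvec (sym_tensor t l j') 0 a)); last first.
  by move=> a _; rewrite [in LHS]mxE [in RHS]mxE [sym_col t l a j']mxE.
rewrite sum_sym_col.
(* The two weights contribute [t] and [1 - t], so the trace is independent of [t]. *)
have -> : \tr (sym_tensor t l j') = (l == j')%:R.
  rewrite /mxtrace.
  under eq_bigr do rewrite !mxE eqxx mulr1.
  rewrite big_split -mulr_sumr big_split /= !sum_eqr sumr_const card_ord.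
  by rewrite -mulr_natr [j' == l]eq_sym; field.
rewrite !mxE [j == k]eq_sym [j' == j]eq_sym [l == k]eq_sym [j' == k]eq_sym.
set a := (k == l)%:R; set b := (j == j')%:R; set c := (k == j')%:R.
set d := (l == j)%:R; set e := (k == j)%:R; set f := (l == j')%:R.
transitivity (t ^+ 2 / 2 * (a * b + c * d) + (1 - t ^+ 2) / m%:R * e * f); first by field.
by rewrite t2; field; rewrite m0 m2.
Qed.

(** * Quadratic forms, and the factors of [W] and [A] *)

Lemma mx11_mulE (R : realType) (p q : nat) (x : 'cV[R]_p) (A : 'M[R]_(p, q))
    (y : 'cV[R]_q) :
  (x^T *m A *m y) 0 0 = \sum_i \sum_j x i 0 * A i j * y j 0.
Proof.
rewrite mxE exchange_big; apply: eq_bigr => j _.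
by rewrite mxE mulr_suml; apply: eq_bigr => i _; rewrite mxE.
Qed.

Lemma psd_mulmx_tr (R : realType) (p q : nat) (F : 'M[R]_(p, q)) :
  psd (F *m F^T).
Proof.
split=> [|x]; first by rewrite trmx_mul trmxK.
rewrite -mulmxA -mulmxA mulmxA -[X in (_ *m X) 0 0]trmxK trmx_mul trmxK mxE.
by apply: sumr_ge0 => i _; rewrite [_^T i 0]mxE -expr2 sqr_ge0.
Qed.

(** The factor [F] of the relaxed solution [W = F *m F^T], with one column for each coordinate of
    [g]. *)
Definition sym_mx {R : realType} (m : nat) (t : R) : 'M[R]_(m * (m * m), m) :=
  \matrix_(p, k) vec (sym_col t k) p 0.

(* [trace_mx *m vec X] lists the traces of the columns of [X], read as m x m
   matrices. *)
Definition trace_mx (R : realType) (m : nat) : 'M[R]_(m, m * (m * m)) :=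
  \matrix_(j, p) vec (\matrix_(a, j') ((j == j')%:R * mxvec (1%:M : 'M[R]_m) 0 a)) p 0.

Lemma sym_mxE (R : realType) (m : nat) (t : R) (k j : 'I_m) a :
  sym_mx m t (mxvec_index j a) k = sym_col t k a j.
Proof. by rewrite mxE vecE. Qed.

Lemma trace_mxE (R : realType) (m : nat) (j j' : 'I_m) a :
  trace_mx R m j (mxvec_index j' a) = (j == j')%:R * mxvec 1%:M 0 a.
Proof. by rewrite mxE vecE mxE. Qed.

Lemma sym_mxM (R : realType) (m : nat) (t : R) (g : 'cV[R]_m) :
  sym_mx m t *m g = vec (\sum_k g k 0 *: sym_col t k).
Proof.
apply/colP => p; case/mxvec_indexP: p => j a.
rewrite [LHS]mxE [RHS]vecE summxE; apply: eq_bigr => k _.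
by rewrite sym_mxE [RHS]mxE mulrC.
Qed.

Lemma trace_mxM (R : realType) (m : nat) (X : 'M[R]_(m * m, m)) :
  trace_mx R m *m vec X = X^T *m (mxvec 1%:M)^T.
Proof.
apply/colP => j; rewrite [LHS]mxE sum_mxvec_index [RHS]mxE exchange_big.
apply: eq_bigr => a _; rewrite [X^T _ _]mxE [(mxvec _)^T _ _]mxE.
rewrite -[RHS](sum_eqr j (fun j => X a j * mxvec 1%:M 0 a)).
by apply: eq_bigr => j' _; rewrite trace_mxE vecE -mulrA [X a j' * _]mulrC.
Qed.

(** Contracting the Gram tensor over [j = j'] gives weights [m], 1 and 1 on the same delta, which
    cancel [m + 2]. *)
Lemma sym_mx_orthonormal (R : realType) (m : nat) (t : R) :
  t ^+ 2 = 2 / (m%:R + 2) -> (sym_mx m t)^T *m sym_mx m t = 1%:M.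
Proof.
move=> t2; have m2 : m%:R + 2 != 0 :> R by rewrite -natrD pnatr_eq0 addn2.
apply/matrixP => k l; rewrite [LHS]mxE [RHS]mxE sum_mxvec_index.
under eq_bigr => j _.
  under eq_bigr do rewrite [_^T _ _]mxE !sym_mxE.
  rewrite gram_sym_col // eqxx mulr1.
over.
rewrite -mulr_suml !big_split /= !sum_eqr sumr_const card_ord.
by rewrite -mulr_natr [l == k]eq_sym; field.
Qed.

(** Matrix form of [G^T vec I = g], valid for every [t]. *)
Lemma trace_sym_mx (R : realType) (m : nat) (t : R) :
  trace_mx R m *m sym_mx m t = 1%:M.
Proof.
apply/matrixP => j k.
have -> : (trace_mx R m *m sym_mx m t) j k = (trace_mx R m *m vec (sym_col t k)) j 0.
  by rewrite !mxE; apply: eq_bigr => p _; rewrite [sym_mx _ _ _ _]mxE.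
rewrite trace_mxM mxE.
under eq_bigr do rewrite [_^T _ _]mxE [_^T _ _]mxE.
have m0 : m%:R != 0 :> R by rewrite pnatr_eq0; case: m j {k} => [[]|].
rewrite sum_sym_col mxtrace1 !mxE [j == k]eq_sym.
by field.
Qed.

Lemma block_sym_mx (R : realType) (m : nat) (t : R) (j j' : 'I_m) a b :
  block (sym_mx m t *m (sym_mx m t)^T) j j' a b =
  \sum_k sym_col t k a j * sym_col t k b j'.
Proof.
rewrite mxE mxE; apply: eq_bigr => k _.
by rewrite [_^T _ _]mxE !sym_mxE.
Qed.

(** By total symmetry, contracting the Gram tensor over [k = l] gives the same count [m + 1 + 1]. *)
Lemma tr_block_sym_mx (R : realType) (m : nat) (t : R) (j j' : 'I_m) :
  t ^+ 2 = 2 / (m%:R + 2) ->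
  \tr (block (sym_mx m t *m (sym_mx m t)^T) j j') = (j == j')%:R.
Proof.
move=> t2; have m2 : m%:R + 2 != 0 :> R by rewrite -natrD pnatr_eq0 addn2.
rewrite /mxtrace; under eq_bigr do rewrite block_sym_mx.
rewrite exchange_big.
under eq_bigr => k _.
  rewrite gram_sym_col // eqxx mul1r [k == j']eq_sym [k == j]eq_sym.
  rewrite [X in _ + X + _]mulrC.
over.
rewrite -mulr_suml !big_split /= !sum_eqr sumr_const card_ord.
by rewrite -mulr_natr [j' == j]eq_sym; field.
Qed.

(** * The Loewner constraint *)

Lemma sqr_sum_le (R : realType) (m : nat) (x : 'I_m -> R) :
  (\sum_i x i) ^+ 2 <= m%:R * \sum_i x i ^+ 2.
Proof.
case: m x => [|m] x; first by rewrite big_ord0 expr0n mul0r.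
set s := \sum_i x i; have m0 : 0 < m.+1%:R :> R by rewrite ltr0n.
have : 0 <= \sum_i (m.+1%:R * x i - s) ^+ 2 by apply: sumr_ge0 => i _; exact: sqr_ge0.
rewrite (eq_bigr (fun i => m.+1%:R ^+ 2 * x i ^+ 2 + (- (2 * m.+1%:R * s)) * x i + s ^+ 2));
  last by move=> i _; ring.
rewrite !big_split -!mulr_sumr /= sumr_const card_ord -/s -mulr_natr => h.
rewrite -(ler_pM2l m0) -subr_ge0; apply: le_trans h _.
by rewrite le_eqVlt; apply/orP; left; apply/eqP; ring.
Qed.

(** The left side is [t ^+ 2] times the squared norm of the symmetric part of [Y], plus [1 - t ^+ 2]
    times [(\tr Y) ^+ 2 / m]: a convex combination of two quantities bounded by the squared norm of
    [Y]. *)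
Lemma sym_col_bessel (R : realType) (m : nat) (t : R) (Y : 'M[R]_m) :
  (0 < m)%N -> t ^+ 2 <= 1 ->
  \sum_i \sum_k (\sum_a sym_col t k a i * mxvec Y 0 a) ^+ 2 <=
  \sum_k \sum_l Y k l ^+ 2.
Proof.
move=> m0 t1; set N := (X in _ <= X).
have m0R : 0 < m%:R :> R by rewrite ltr0n.
have sym_le : \sum_i \sum_k (Y k i + Y i k) ^+ 2 <= 4 * N.
  have -> : 4 * N = \sum_i \sum_k (2 * Y k i ^+ 2 + 2 * Y i k ^+ 2).
    transitivity (2 * N + 2 * N); first by ring.
    under [RHS]eq_bigr do rewrite big_split -!mulr_sumr.
    by rewrite big_split -!mulr_sumr /= [in RHS]exchange_big.
  apply: ler_sum => i _; apply: ler_sum => k _; rewrite -subr_ge0.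
  by rewrite (_ : _ - _ = (Y k i - Y i k) ^+ 2) ?sqr_ge0 //; ring.
have tr_le : (\tr Y) ^+ 2 / m%:R <= N.
  rewrite ler_pdivrMr // mulrC; apply: le_trans (sqr_sum_le _) _.
  rewrite ler_pM2l //; apply: ler_sum => k _.
  by rewrite (bigD1 k) //= lerDl; apply: sumr_ge0 => l _; exact: sqr_ge0.
have -> : \sum_i \sum_k (\sum_a sym_col t k a i * mxvec Y 0 a) ^+ 2 =
    t ^+ 2 / 4 * (\sum_i \sum_k (Y k i + Y i k) ^+ 2) +
    (1 - t ^+ 2) * ((\tr Y) ^+ 2 / m%:R).
  transitivity (\sum_i (t ^+ 2 / 4 * (\sum_k (Y k i + Y i k) ^+ 2) +
     2 * t * (1 - t) / m%:R * \tr Y * Y i i + ((1 - t) / m%:R * \tr Y) ^+ 2)).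
    apply: eq_bigr => i _.
    transitivity (\sum_k (t ^+ 2 / 4 * (Y k i + Y i k) ^+ 2 +
      (i == k)%:R * (t * (1 - t) / m%:R * (Y k i + Y i k) * \tr Y +
        ((1 - t) / m%:R * \tr Y) ^+ 2))).
      apply: eq_bigr => k _; rewrite sum_sym_col [k == i]eq_sym.
      by case: eqP => _; rewrite ?mulr1 ?mulr0 ?mul1r ?mul0r; field; rewrite ?gt_eqF.
    rewrite big_split -mulr_sumr /= sum_eqr -addrA; congr (_ + _).
    by field; rewrite gt_eqF.
  (* The trace terms combine through [2 t (1 - t) + (1 - t)^2 = 1 - t^2]. *)
  rewrite big_split big_split -!mulr_sumr /= sumr_const card_ord -/(mxtrace Y).
  by rewrite -mulr_natr; field; rewrite gt_eqF.
apply: (@le_trans _ _ (t ^+ 2 / 4 * (4 * N) + (1 - t ^+ 2) * N)).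
  apply: lerD; apply: ler_wpM2l => //; last by rewrite subr_ge0.
  by apply: divr_ge0 => //; exact: sqr_ge0.
by rewrite le_eqVlt; apply/orP; left; apply/eqP; field.
Qed.

(** Once [y] is reshaped into an m x m matrix, the quadratic form of the block sum is the left side
    of the Bessel bound. *)
Lemma loewner_sym_mx (R : realType) (m : nat) (t : R) : (0 < m)%N -> t ^+ 2 <= 1 ->
  loewner_le (\sum_(i < m) block (sym_mx m t *m (sym_mx m t)^T) i i) 1%:M.
Proof.
move=> m0 t1; split=> [|y].
  apply/matrixP => a b; rewrite !mxE !summxE [a == b]eq_sym; congr (_ - _).
  apply: eq_bigr => i _; rewrite !block_sym_mx.
  by apply: eq_bigr => k _; rewrite mulrC.
rewrite mulmxBr mulmxBl mulmx1 mxE [X in _ + X]mxE subr_ge0.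
have yE a : y a 0 = mxvec (vec_mx y^T) 0 a by rewrite vec_mxK mxE.
rewrite mx11_mulE.
have -> : (\sum_i \sum_j y i 0 *
    (\sum_(i0 < m) block (sym_mx m t *m (sym_mx m t)^T) i0 i0) i j * y j 0) =
    \sum_(i < m) \sum_k (\sum_a sym_col t k a i * mxvec (vec_mx y^T) 0 a) ^+ 2.
  under eq_bigr => a _.
    under eq_bigr => b _.
      rewrite summxE; under eq_bigr do rewrite block_sym_mx.
      rewrite mulr_sumr mulr_suml.
      under eq_bigr do rewrite mulr_sumr mulr_suml.
    over.
    rewrite exchange_big; under eq_bigr do rewrite exchange_big.
  over.
  rewrite exchange_big; apply: eq_bigr => i _.
  rewrite exchange_big; apply: eq_bigr => k _.
  rewrite expr2 mulr_suml; apply: eq_bigr => a _.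
  rewrite mulr_sumr; apply: eq_bigr => b _.
  by rewrite -!yE; ring.
apply: le_trans (sym_col_bessel _ m0 t1) _.
rewrite mxE sum_mxvec_index le_eqVlt; apply/orP; left; apply/eqP.
apply: eq_bigr => k _; apply: eq_bigr => l _.
by rewrite yE mxvecE [_^T _ _]mxE yE mxvecE expr2.
Qed.

(** * Objective value of the relaxation and of the rounding *)

(** Row [j] of [trace_mx] is supported on the [j]-th stacked column, so only diagonal blocks enter
    the objective; the Loewner constraint can then bound it. *)
Lemma frobenius_trace_mx (R : realType) (m : nat) (W : 'M[R]_(m * (m * m))) :
  frobenius ((trace_mx R m)^T *m trace_mx R m) W =
  (mxvec 1%:M *m (\sum_i block W i i) *m (mxvec 1%:M)^T) 0 0.
Proof.
have -> : frobenius ((trace_mx R m)^T *m trace_mx R m) W =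
    \sum_j (trace_mx R m *m W *m (trace_mx R m)^T) j j.
  by rewrite -[RHS]/(\tr _) [RHS]mxtrace_mulC mulmxA /frobenius trmx_mul trmxK.
rewrite -[X in (X *m _ *m _) 0 0]trmxK mx11_mulE.
under [RHS]eq_bigr => a _.
  under eq_bigr do rewrite summxE mulr_sumr mulr_suml.
  rewrite exchange_big.
over.
rewrite [RHS]exchange_big; apply: eq_bigr => j _ /=.
rewrite [LHS]mxE sum_mxvec_index.
transitivity (\sum_j' (j == j')%:R *
    \sum_b \sum_a mxvec 1%:M 0 a * W (mxvec_index j a) (mxvec_index j' b) *
      mxvec 1%:M 0 b).
  apply: eq_bigr => j' _; rewrite mulr_sumr; apply: eq_bigr => b _.
  rewrite [_^T _ _]mxE trace_mxE mulrCA; congr (_ * _).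
  rewrite [X in X * _]mxE -mulr_suml sum_mxvec_index; congr (_ * _).
  rewrite -[RHS](sum_eqr j (fun i => \sum_a mxvec 1%:M 0 a *
    W (mxvec_index i a) (mxvec_index j' b))).
  apply: eq_bigr => i _; rewrite mulr_sumr; apply: eq_bigr => a _.
  by rewrite trace_mxE mulrA.
rewrite sum_eqr exchange_big; apply: eq_bigr => a _; apply: eq_bigr => b _.
by rewrite ![(mxvec _)^T _ _]mxE [block _ _ _ _ _]mxE.
Qed.

(** Contracting the Gram tensor with [g] twice turns one delta product into the scalar matrix and
    each of the other two into [g *m g^T]. *)
Lemma sym_col_comb_gram (R : realType) (m : nat) (t : R) (g : 'cV[R]_m) :
  t ^+ 2 = 2 / (m%:R + 2) ->
  let G := \sum_k g k 0 *: sym_col t k in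
  G^T *m G = (m%:R + 2)^-1 *: (((g^T *m g) 0 0)%:M + 2 *: (g *m g^T)).
Proof.
move=> t2 /=; apply/matrixP => j j'; rewrite [LHS]mxE.
transitivity (\sum_k \sum_l g k 0 * g l 0 *
    \sum_a sym_col t k a j * sym_col t l a j').
  under [LHS]eq_bigr => a _.
    rewrite [_^T _ _]mxE !summxE mulr_suml.
    under eq_bigr do rewrite mulr_sumr.
  over.
  rewrite exchange_big; apply: eq_bigr => k _.
  rewrite exchange_big; apply: eq_bigr => l _.
  rewrite mulr_sumr; apply: eq_bigr => a _.
  by rewrite [(g k 0 *: sym_col t k) a j]mxE [(g l 0 *: sym_col t l) a j']mxE; ring.
transitivity (\sum_k (m%:R + 2)^-1 * ((j == j')%:R * g k 0 ^+ 2 +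
    (j' == k)%:R * (g k 0 * g j 0) + (j == k)%:R * (g k 0 * g j' 0))).
  apply: eq_bigr => k _.
  transitivity (\sum_l (m%:R + 2)^-1 * ((k == l)%:R * (g k 0 * g l 0 * (j == j')%:R) +
    (j == l)%:R * (g k 0 * g l 0 * (j' == k)%:R) +
    (j' == l)%:R * (g k 0 * g l 0 * (j == k)%:R))).
    apply: eq_bigr => l _; rewrite gram_sym_col //.
    by rewrite [j == l]eq_sym [j' == l]eq_sym [j' == k]eq_sym [j == k]eq_sym; ring.
  by rewrite -mulr_sumr !big_split /= !sum_eqr; ring.
rewrite -mulr_sumr !big_split -mulr_sumr /= !sum_eqr.
have gg : (g^T *m g) 0 0 = \sum_k g k 0 ^+ 2.
  by rewrite mxE; apply: eq_bigr => k _; rewrite mxE.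
have ggT : (g *m g^T) j j' = g j 0 * g j' 0.
  by rewrite mxE big_ord1 mxE.
have sE : (((g^T *m g) 0 0)%:M : 'M[R]_m) j j' = (\sum_k g k 0 ^+ 2) * (j == j')%:R.
  by rewrite mxE gg mulr_natr.
by rewrite [RHS]mxE; congr (_ * _); rewrite mxE sE [(2 *: (g *m g^T)) j j']mxE ggT; ring.
Qed.

Lemma sym_col_projection (R : realType) (m : nat) (t : R) (g : 'cV[R]_m)
    (Q : 'M[R]_(m * m, m)) :
  t ^+ 2 = 2 / (m%:R + 2) -> g != 0 ->
  projection_of (\sum_k g k 0 *: sym_col t k) Q ->
  ((vec Q)^T *m ((trace_mx R m)^T *m trace_mx R m) *m vec Q) 0 0 =
  (m%:R + 2) / 3.
Proof.
move=> t2 g0; set G := \sum_k _ => GQ.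
have m2 : m%:R + 2 != 0 :> R by rewrite -natrD pnatr_eq0 addn2.
set s := (g^T *m g) 0 0.
have gg : g^T *m g = s%:M by rewrite [LHS]mx11_scalar.
have s0 : s != 0.
  apply: contra g0 => /eqP; rewrite /s mxE => s0.
  have h k : g k 0 ^+ 2 = 0.
    apply/eqP; have := s0.
    rewrite (eq_bigr (fun k => g k 0 ^+ 2)); last by move=> i _; rewrite mxE.
    move=> /eqP; rewrite psumr_eq0; last by move=> i _; exact: sqr_ge0.
    by move=> /allP /(_ k); apply; rewrite mem_index_enum.
  by apply/eqP/colP => k; rewrite mxE; apply/eqP; rewrite -sqrf_eq0 h.
(* Sherman-Morrison inverse of the Gram matrix; the 3 is [1 + 2], from the rank-one term
   [2 g g^T]. *)
pose N := ((m%:R + 2) / s) *: (1%:M - (2 / (3 * s)) *: (g *m g^T)) : 'M[R]_m.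
have GN : G^T *m G *m N = 1%:M.
  rewrite sym_col_comb_gram // -/s /N -scalemxAr -scalemxAl scalerA.
  rewrite mulmxBr mulmx1 mulmxDl mul_scalar_mx scalerA -scalemxAr -scalemxAl.
  rewrite mulmxA -(mulmxA g) gg mul_mx_scalar -!scalemxAl !scalerA.
  set H := g *m g^T; apply/matrixP => i j; rewrite !mxE; set b := (i == j).
  by case: b; rewrite /= ?mulr1n ?mulr0n; field; rewrite ?s0 ?m2.
have GI : G^T *m (mxvec 1%:M)^T = g.
  by rewrite -trace_mxM -sym_mxM mulmxA trace_sym_mx mul1mx.
have IG : mxvec 1%:M *m G = g^T by rewrite -GI trmx_mul !trmxK.
rewrite -mulmxA -mulmxA trace_mxM mulmxA -trmx_mul trace_mxM trmx_mul !trmxK.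
rewrite mulmxA -(mulmxA _ Q) (projection_mul_tr GQ GN).
rewrite !mulmxA IG -mulmxA GI /N -scalemxAr -scalemxAl mulmxBr mulmx1.
rewrite -scalemxAr mulmxA gg mulmxBl gg -scalemxAl mul_scalar_mx -scalemxAl gg.
by rewrite !mxE eqxx !mulr1n; field; rewrite ?s0 ?m2.
Qed.

Theorem proposition4 (R : realType) (q m : nat)
    (hq : (1 <= q)%N) (hm : m = (2 ^ q)%N) :
  exists (n : nat) (A W : 'M[R]_(m * n)),
    [/\ (m <= n)%N, A != 0 /\ psd A, optimal A W &
        forall (disp : measure_display) (T : measurableType disp)
          (P : probability T R) (Q : T -> 'M[R]_(n, m)),
        relax_and_project P W Q ->
        {ae P, forall w,
          ((vec (Q w))^T *m A *m vec (Q w)) 0 0 =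
          (m%:R + 2) / (3 * m%:R) * frobenius A W}].
Proof.
have m0 : (0 < m)%N by rewrite hm expn_gt0.
have m0R : m%:R != 0 :> R by rewrite pnatr_eq0 -lt0n.
have m2 : 0 < m%:R + 2 :> R by rewrite -natrD ltr0n addn2.
pose t := Num.sqrt (2 / (m%:R + 2) : R).
have t2 : t ^+ 2 = 2 / (m%:R + 2) by rewrite sqr_sqrtr // divr_ge0 // ltW.
have t1 : t ^+ 2 <= 1 by rewrite t2 ler_pdivrMr // mul1r lerDr ler0n.
pose C := trace_mx R m; pose F := sym_mx m t.
have FF : F^T *m F = 1%:M by exact: sym_mx_orthonormal.
(* By cyclicity the trace is that of [(C *m F)^T *m (C *m F)], and [C *m F] is the identity of size
   [m]. *)
have AW : frobenius (C^T *m C) (F *m F^T) = m%:R.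
  rewrite /frobenius trmx_mul trmxK -mulmxA mxtrace_mulC -!mulmxA.
  by rewrite -trmx_mul trace_sym_mx trmx1 mulmx1 trace_sym_mx mxtrace1.
exists (m * m)%N, (C^T *m C), (F *m F^T); split.
- by rewrite leq_pmulr.
- split; last by rewrite -[X in _ *m X](trmxK C); exact: psd_mulmx_tr.
  apply: contraNneq m0R => A0.
  by rewrite -AW A0 /frobenius trmx0 mul0mx mxtrace0.
- split=> [|W' [_ [_ W'le] _]].
    split; [exact: psd_mulmx_tr|exact: loewner_sym_mx|].
    by move=> j j'; exact: tr_block_sym_mx.
  rewrite AW frobenius_trace_mx.
  (* The Loewner constraint tested at [vec I] bounds the objective by the squared norm of [vec I],
     which is [m]. *)
  have := W'le (mxvec 1%:M)^T; rewrite trmxK mulmxBr mulmxBl mulmx1 mxE.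
  rewrite [X in _ + X]mxE subr_ge0 => /le_trans -> //.
  rewrite mxE sum_mxvec_index.
  under eq_bigr => i _.
    under eq_bigr do rewrite [(mxvec _)^T _ _]mxE mxvecE mxE -natrM mulnb andbb -[_%:R]mulr1.
    rewrite sum_eqr.
  over.
  by rewrite sumr_const card_ord.
- move=> disp T P Q [G [gG GQ]].
  have Gne0 := gaussian_neq0 gG FF m0.
  apply: filterS2 (gaussian_range gG FF) Gne0 => w Gw Gw0.
  rewrite AW; have := @sym_col_projection R m t (F^T *m vec (G w)) (Q w) t2 Gw0.
  (* On the almost sure event, [G w] is the combination of the [sym_col t k] with coefficients
     [F^T *m vec (G w)], which play the part of [g]. *)
  rewrite -(vec_inj (etrans Gw (sym_mxM t _))).
  by move=> /(_ (GQ w)) ->; field.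
Qed.
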